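(* Let $m\ge 1$ and $n\ge 0$ be integers. The number of partitions $\lambda$ of $n$ having a $0$-fixed hook in the $m$th column (i.e. for which there is a row index $i$ with $\lambda_i\ge m$ and $h_{i,m}(\lambda)=i$) equals \[ \sum_{L\ge 1} \#\Big\{(\mu,\nu)\ :\ |\mu|+|\nu|=n,\ \text{the part } L \text{ appears exactly } L+m-1 \text{ times in } \mu,\ \text{and none of } L+1,L+2,\ldots,L+2m-2 \text{ is a part of } \mu\Big\}, \] where $\mu$ ranges over all partitions (the parts of the ''first color'') and $\nu$ ranges over all partitions all of whose parts lie in $\{1,2,\ldots,m-1\}$ (the parts of the ''second color''). Equivalently, this is the total number of times, across all partitions of $n$ with two colors of parts $1,2,\ldots,m-1$, that some part of size $L$ appears exactly $L+m-1$ times in the first color while $L+1,\ldots,L+2m-2$ are not parts in the first color.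
   Context: A partition $\lambda=(\lambda_1\ge\lambda_2\ge\cdots\ge\lambda_r>0)$ of $n$ has Young diagram with cells $(i,j)$, $1\le i\le r$, $1\le j\le\lambda_i$; $\lambda'$ denotes the conjugate partition. The hook length of the cell $(i,j)$ is $h_{i,j}(\lambda)=\lambda_i+\lambda'_j-i-j+1$. For an integer $h$, $\lambda$ has an $h$-fixed hook in the $m$th column if there is a row $i$ with $\lambda_i\ge m$ and $h_{i,m}(\lambda)=i+h$. A ''partition of $n$ with two colors of parts $1,\ldots,m-1$'' is a partition of $n$ in which each part of size at most $m-1$ carries one of two colors (first or second) and every part of size at least $m$ carries the first color. *)

(* Defs.v *)
From HB Require Import structures.
From mathcomp Require Import all_boot all_order all_algebra.
From mathcomp Require Import boolp classical_sets functions cardinality fsbigop.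

Set Implicit Arguments.
Unset Strict Implicit.
Unset Printing Implicit Defensive.

Import GRing.Theory.

Local Open Scope nat_scope.

(* A partition is the nonincreasing sequence of its (positive) parts. *)
Definition is_partition (s : seq nat) : bool := sorted geq s && (0 \notin s).

Record intpart (n : nat) : Type := IntPart {
  parts :> seq nat;
  _ : is_partition parts && (sumn parts == n) }.

HB.instance Definition _ n := [isSub for @parts n].
HB.instance Definition _ n := [Countable of intpart n by <:].

(* Partitions of n in which each part smaller than m carries one of two colors:
   [first_color] lists the parts of the first color (of any size) and
   [second_color] those of the second color (of size at most m - 1). *)
Definition is_two_colored (m n : nat) (p : seq nat * seq nat) : bool :=
  [&& is_partition p.1, is_partition p.2, all (fun k => k < m) p.2
    & sumn p.1 + sumn p.2 == n].

Record two_colored (m n : nat) : Type := TwoColored {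
  colors : seq nat * seq nat;
  _ : is_two_colored m n colors }.

HB.instance Definition _ m n := [isSub for @colors m n].
HB.instance Definition _ m n := [Countable of two_colored m n by <:].

Definition first_color m n (p : two_colored m n) : seq nat := (colors p).1.
Definition second_color m n (p : two_colored m n) : seq nat := (colors p).2.

(* Finiteness: a partition of some k <= n has at most n parts, each at most n. *)
Definition bcode (n : nat) (s : seq nat) : n.-bseq 'I_n.+1 :=
  insub_bseq n (map inord s).

Definition bdecode (n : nat) (b : n.-bseq 'I_n.+1) : seq nat := map val b.

Lemma leq_sumn_mem (s : seq nat) (k : nat) : k \in s -> k <= sumn s.
Proof.
elim: s => //= a s IHs; rewrite inE => /orP[/eqP->|/IHs ks].
  exact: leq_addr.
exact: leq_trans ks (leq_addl _ _).
Qed.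

Lemma bcodeK (n : nat) (s : seq nat) :
  is_partition s -> sumn s <= n -> bdecode (bcode n s) = s.
Proof.
move=> /andP[_ s0] sn; rewrite /bdecode /bcode /insub_bseq val_insubd size_map.
have -> : size s <= n.
  apply: leq_trans sn; elim: s s0 => //= a s IHs.
  by rewrite inE negb_or eq_sym -lt0n => /andP[a0 /IHs]; exact: leq_add a0.
rewrite -map_comp -[RHS]map_id; apply/eq_in_map => k ks /=.
by rewrite inordK // ltnS (leq_trans (leq_sumn_mem ks)).
Qed.

Definition intpart_code n (p : intpart n) : n.-bseq 'I_n.+1 := bcode n p.
Definition intpart_decode n (b : n.-bseq 'I_n.+1) : option (intpart n) :=
  insub (bdecode b).

Lemma intpart_codeK n : pcancel (@intpart_code n) (@intpart_decode n).
Proof.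
move=> p; rewrite /intpart_decode /intpart_code.
by have /andP[ps /eqP pn] := valP p; rewrite bcodeK ?pn // valK.
Qed.

HB.instance Definition _ n : isFinite (intpart n) :=
  PCanIsFinite (@intpart_codeK n).

Definition two_colored_code m n (p : two_colored m n) :
    n.-bseq 'I_n.+1 * n.-bseq 'I_n.+1 :=
  (bcode n (first_color p), bcode n (second_color p)).
Definition two_colored_decode m n (b : n.-bseq 'I_n.+1 * n.-bseq 'I_n.+1) :
    option (two_colored m n) :=
  insub (bdecode b.1, bdecode b.2).

Lemma two_colored_codeK m n :
  pcancel (@two_colored_code m n) (@two_colored_decode m n).
Proof.
case=> [[mu nu] p_mu_nu]; have /and4P[/= mup nup _ /eqP sum_n] := p_mu_nu.
rewrite /two_colored_decode /two_colored_code /first_color /second_color /=.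
rewrite !bcodeK //; first by rewrite insubT; congr Some; apply: val_inj.
  by rewrite -[X in _ <= X]sum_n leq_addl.
by rewrite -[X in _ <= X]sum_n leq_addr.
Qed.

HB.instance Definition _ m n : isFinite (two_colored m n) :=
  PCanIsFinite (@two_colored_codeK m n).

(* Rows and columns are numbered from 1; these are lambda_i (0 beyond the last
   row) and lambda'_j. *)
Definition row_length (lam : seq nat) (i : nat) : nat := nth 0 lam i.-1.
Definition col_length (lam : seq nat) (j : nat) : nat :=
  count (fun k => j <= k) lam.

Definition hook_length (lam : seq nat) (i j : nat) : int :=
  ((row_length lam i)%:Z + (col_length lam j)%:Z - i%:Z - j%:Z + 1)%R.

Definition has_fixed_hook (h : int) (m : nat) (lam : seq nat) : bool :=
  has (fun i => (m <= row_length lam i) && (hook_length lam i m == i%:Z + h)%R)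
      (iota 1 (size lam)).

(* L appears exactly L + m - 1 times in mu, and none of L + 1, ..., L + 2m - 2
   is a part of mu; the truncated subtractions are exact for L, m >= 1. *)
Definition frequency_gap (m L : nat) (mu : seq nat) : bool :=
  (count_mem L mu == L + m - 1)
  && all (fun k => k \notin mu) (index_iota (L + 1) (L + 2 * m - 2).+1).

Definition n_fixed_hook (h : int) (m n : nat) : nat :=
  #|[pred lam : intpart n | has_fixed_hook h m lam]|.

Definition n_frequency_gap (m n L : nat) : nat :=
  #|[pred p : two_colored m n | frequency_gap m L (first_color p)]|.

(* For fixed p, L ranges over the distinct parts of the first color. *)
Definition n_occurrences (m n : nat) : nat :=
  \sum_(p : two_colored m n)
    count (fun L => frequency_gap m L (first_color p)) (undup (first_color p)).

(* The sum over all L >= 1 has finite support, so that the finitely supported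
   sum \sum_(L \in _) really is that sum. *)
Lemma n_frequency_gap_eq0 (m n L : nat) :
  0 < m -> n < L -> n_frequency_gap m n L = 0.
Proof.
move=> m0 nL; apply: eq_card0 => p; rewrite !inE /frequency_gap.
apply/negbTE; rewrite negb_and; apply/orP; left; apply/eqP => cL.
have L1 : L \in first_color p.
  rewrite -has_pred1 has_count cL subn_gt0 -[1]/(0 + 1).
  by case: L nL {cL} => // L _; rewrite addSn ltnS addn_gt0 m0 orbT.
have /and4P[_ _ _ /eqP pn] := valP p.
have := leq_trans (leq_sumn_mem L1) (leq_addr (sumn (second_color p)) _).
by rewrite [X in _ <= X]pn leqNgt nL.
Qed.

(* Main.v *)
(* A 0-fixed hook at row i of column m, with arm t and leg s, has i = t + s + 1.
   The parts of lambda below m form the second color; the others are the t + s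
   parts m + t + g_k above row i, the part m + t, and the s parts m + b_k with
   0 <= b_k <= t below it.  In terms of generating functions, the identity
   binom(t + s, s)_q / (q)_(t + s) = 1 / ((q)_t (q)_s) trades the pair (g, b) for
   a sequence c of length t and a sequence e of length s; bijectively, the
   elements of e are inserted into c one by one, an element d splitting into an
   entry d - j of g placed at position j and an entry j of b.  With L = t + 1 the
   first color then consists of the s parts 2 m + t + e_k >= L + 2 m - 1, of
   L + m - 1 parts L, and of the conjugate of c, whose parts are less than L. *)

Require Import Defs.
From mathcomp Require Import all_boot all_order all_algebra.
From mathcomp Require Import boolp classical_sets functions cardinality fsbigop.
From mathcomp Require Import zify.

Set Implicit Arguments.
Unset Strict Implicit.
Unset Printing Implicit Defensive.

Local Open Scope nat_scope.

(** * Sliding insertion of one element into an increasing sequence *)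

(* [slide_in] inserts d - j at position j, where j = [slide_pos d g] is the least
   position at which d - j does not exceed the entry it pushes to the right; on
   increasing sequences, (d, g) |-> (j, new sequence) is bijective. *)
Fixpoint slide_pos (d : nat) (g : seq nat) : nat :=
  if g is x :: g' then if d <= x then 0 else (slide_pos d.-1 g').+1 else 0.

Fixpoint slide_in (d : nat) (g : seq nat) : seq nat :=
  if g is x :: g' then if d <= x then d :: g else x :: slide_in d.-1 g'
  else [:: d].

Fixpoint delete_nth (j : nat) (g : seq nat) : seq nat :=
  if g is x :: g' then if j is j'.+1 then x :: delete_nth j' g' else g'
  else [::].

Lemma size_slide_in d g : size (slide_in d g) = (size g).+1.
Proof. by elim: g d => //= x g IHg d; case: ifP => //= _; rewrite IHg. Qed.

Lemma slide_pos_le d g : slide_pos d g <= size g.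
Proof. by elim: g d => //= x g IHg d; case: ifP => // _; rewrite ltnS IHg. Qed.

Lemma slide_pos_leq_nth d g k :
  k < size g -> d <= nth 0 g k + k -> slide_pos d g <= k.
Proof.
elim: g d k => //= x g IHg d [|k] /=; first by rewrite addn0 => _ ->.
by rewrite ltnS => kg dk; case: ifP => // _; apply: IHg => //; lia.
Qed.

Lemma nth_slide_in d g : nth 0 (slide_in d g) (slide_pos d g) + slide_pos d g = d.
Proof.
elim: g d => [|x g IHg] d /=; first by rewrite addn0.
case: ifP => dx /=; first by rewrite addn0.
by have := IHg d.-1; lia.
Qed.

Lemma delete_slide_in d g : delete_nth (slide_pos d g) (slide_in d g) = g.
Proof. by elim: g d => //= x g IHg d; case: ifP => //= _; rewrite IHg. Qed.

Lemma path_slide_in p d g : p <= d -> path leq p g -> path leq p (slide_in d g).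
Proof.
elim: g p d => [|x g IHg] p d /= pd; first by rewrite pd.
move=> /andP[px xg]; case: ifP => dx /=; first by rewrite pd dx.
by rewrite px IHg //; lia.
Qed.

Lemma sorted_slide_in d g : sorted leq g -> sorted leq (slide_in d g).
Proof.
case: g => // x g /= xg; case: ifP => dx /=; first by rewrite dx xg.
by rewrite path_slide_in //; lia.
Qed.

Lemma sumn_delete_nth j g :
  j < size g -> sumn (delete_nth j g) + nth 0 g j = sumn g.
Proof.
elim: g j => //= x g IHg [|j] /=; first by lia.
by rewrite ltnS => /IHg; lia.
Qed.

Lemma size_delete_nth j g : j < size g -> size (delete_nth j g) = (size g).-1.
Proof.
elim: g j => //= x g IHg [|j] //=; rewrite ltnS => jg.
by rewrite IHg // prednK //; apply: leq_ltn_trans jg.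
Qed.

Lemma nth_delete_nth j k g :
  j <= k -> nth 0 (delete_nth j g) k = nth 0 g k.+1.
Proof. by elim: g j k => [|x g IHg] [|j] [|k] //= jk; apply: IHg. Qed.

Lemma subseq_delete_nth j g : subseq (delete_nth j g) g.
Proof.
elim: g j => [|x g IHg] [|j] //=; first exact: (subseq_cons g x).
by rewrite eqxx IHg.
Qed.

Lemma sorted_delete_nth j g : sorted leq g -> sorted leq (delete_nth j g).
Proof. exact: (subseq_sorted leq_trans (subseq_delete_nth j g)). Qed.

(** With [d = nth 0 g j + j], the scan passes every position [i < j], where [d - i] exceeds the
    entry because [g] increases, and stops at [j], since [nth 0 g j] is at most any entry that
    follows it. *)
Lemma slide_delete_nth j g : j < size g -> sorted leq g ->
  slide_pos (nth 0 g j + j) (delete_nth j g) = j /\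
  slide_in (nth 0 g j + j) (delete_nth j g) = g.
Proof.
elim: g j => // x g IHg [|j] /=.
  by rewrite addn0 => _; case: g {IHg} => //= y g /andP[-> _].
rewrite ltnS => jg xg.
have xj : x <= nth 0 g j.
  by have /allP := order_path_min leq_trans xg; apply; apply: mem_nth.
have -> : (nth 0 g j + j.+1 <= x) = false by lia.
by rewrite addnS /=; have [-> ->] := IHg j jg (path_sorted xg).
Qed.

(** * Iterated insertion: the correspondence between [(c, e)] and [(g, b)] *)

(* The largest element of the increasing sequence [e] is inserted first; this
   makes the successive insertion positions decrease, hence [merge_low]
   increase and stay below [size c]. *)
Definition merge_top (c e : seq nat) : seq nat := foldr slide_in c e.

Fixpoint merge_low (c e : seq nat) : seq nat :=
  if e is d :: e' then slide_pos d (merge_top c e') :: merge_low c e' else [::].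

Definition split_core (g b : seq nat) : seq nat :=
  foldl (fun g' j => delete_nth j g') g b.

Fixpoint split_ext (g b : seq nat) : seq nat :=
  if b is j :: b' then (nth 0 g j + j) :: split_ext (delete_nth j g) b'
  else [::].

Lemma size_merge_top c e : size (merge_top c e) = size e + size c.
Proof. by elim: e => //= d e IHe; rewrite size_slide_in IHe. Qed.

Lemma sorted_merge_top c e : sorted leq c -> sorted leq (merge_top c e).
Proof. by move=> sc; elim: e => //= d e; apply: sorted_slide_in. Qed.

Lemma size_merge_low c e : size (merge_low c e) = size e.
Proof. by elim: e => //= d e ->. Qed.

(** Where [d'] was inserted, entry plus position equals [d' >= d], so the least admissible position
    for [d] is no larger. *)
Lemma sorted_merge_low c e : sorted leq e -> sorted leq (merge_low c e).
Proof.
elim: e => //= d [|d' e] //= IHe /andP[dd' d'e]; rewrite IHe // andbT.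
apply: slide_pos_leq_nth; last by rewrite nth_slide_in.
by rewrite size_slide_in ltnS slide_pos_le.
Qed.

(** The last entry is a position in [c] itself, hence at most [size c]; it bounds all the others by
    monotonicity. *)
Lemma merge_low_leq c e :
  sorted leq e -> all (fun j => j <= size c) (merge_low c e).
Proof.
elim: e => // d [|d' e] IHe se; first by rewrite /= slide_pos_le.
have := IHe (path_sorted se).
have := sorted_merge_low c se; rewrite /= => /andP[jj _] /andP[jc ->].
by rewrite jc (leq_trans jj jc).
Qed.

Lemma merge_topK c e : split_core (merge_top c e) (merge_low c e) = c.
Proof. by elim: e => //= d e IHe; rewrite delete_slide_in. Qed.

Lemma merge_lowK c e : split_ext (merge_top c e) (merge_low c e) = e.
Proof. by elim: e => //= d e IHe; rewrite nth_slide_in delete_slide_in IHe. Qed.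

Lemma split_bounds t j k g : j <= t -> size g = k.+1 + t ->
  j < size g /\ size (delete_nth j g) = k + t.
Proof.
move=> jt sg; have jg : j < size g by lia.
by split=> //; rewrite size_delete_nth // sg.
Qed.

Lemma size_split_core t g b : all (fun j => j <= t) b ->
  size g = size b + t -> size (split_core g b) = t.
Proof.
elim: b g => //= j b IHb g /andP[jt bt] sg; have [jg sd] := split_bounds jt sg.
exact: IHb sd.
Qed.

Lemma sorted_split_core g b : sorted leq g -> sorted leq (split_core g b).
Proof. by elim: b g => //= j b IHb g sg; apply/IHb/sorted_delete_nth. Qed.

Lemma size_split_ext g b : size (split_ext g b) = size b.
Proof. by elim: b g => //= j b IHb g; rewrite IHb. Qed.

(** Deleting position [j] shifts later entries by one, so consecutive outputs are [g_j + j] and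
    [g_{j'+1} + j'] with [j <= j']. *)
Lemma sorted_split_ext t g b : all (fun j => j <= t) b ->
  size g = size b + t -> sorted leq g -> sorted leq b ->
  sorted leq (split_ext g b).
Proof.
elim: b g => //= j [|j' b] //= IHb g /andP[jt bt] sg og /andP[jj' ob].
have [jg sd] := split_bounds jt sg.
have := IHb _ _ sd (sorted_delete_nth j og) ob => /(_ bt) ->.
rewrite andbT nth_delete_nth // leq_add //.
apply: (sorted_leq_nth leq_trans leqnn) => //; rewrite ?inE /=; last by lia.
by case/andP: bt; lia.
Qed.

Lemma split_mergeK t g b : all (fun j => j <= t) b ->
  size g = size b + t -> sorted leq g ->
  merge_top (split_core g b) (split_ext g b) = g /\
  merge_low (split_core g b) (split_ext g b) = b.
Proof.
elim: b g => //= j b IHb g /andP[jt bt] sg og; have [jg sd] := split_bounds jt sg.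
have [-> ->] := IHb _ bt sd (sorted_delete_nth j og).
by have [-> ->] := slide_delete_nth jg og.
Qed.

(** Inserting [d] at position [j] adds [d - j] to the sequence and [j] to the list of positions. *)
Lemma sumn_merge c e :
  sumn (merge_top c e) + sumn (merge_low c e) = sumn c + sumn e.
Proof.
elim: e => //= d e IHe; set g := merge_top c e in IHe *.
have := @sumn_delete_nth (slide_pos d g) (slide_in d g).
rewrite size_slide_in ltnS slide_pos_le delete_slide_in => /(_ isT).
by have := nth_slide_in d g; lia.
Qed.

(** * Conjugation of partitions with bounded parts *)

(* Conjugation of a partition with parts at most t into the increasing sequence
   of its numbers of parts >= t, >= t - 1, ..., >= 1 (shifted by p), and back. *)
Fixpoint parts_of_counts (p : nat) (c : seq nat) : seq nat :=
  if c is x :: c' then nseq (x - p) (size c) ++ parts_of_counts x c' else [::].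

Fixpoint counts_of_parts (p t : nat) (s : seq nat) : seq nat :=
  if t is t'.+1 then
    (p + count_mem t s) :: counts_of_parts (p + count_mem t s) t' s
  else [::].

Lemma size_counts_of_parts p t s : size (counts_of_parts p t s) = t.
Proof. by elim: t p => //= t IHt p; rewrite IHt. Qed.

Lemma path_counts_of_parts p t s : path leq p (counts_of_parts p t s).
Proof. by elim: t p => //= t IHt p; rewrite leq_addr IHt. Qed.

Lemma mem_parts_of_counts p c k :
  k \in parts_of_counts p c -> 0 < k <= size c.
Proof.
elim: c p => //= x c IHc p; rewrite mem_cat mem_nseq => /orP[|/IHc].
  by case/andP=> _ /eqP ->; rewrite leqnn.
by case/andP=> -> /leqW.
Qed.

(** The term [p * size c] restores the [p] copies of the largest part that the shift leaves out. *)
Lemma sumn_parts_of_counts p c :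
  path leq p c -> sumn (parts_of_counts p c) + p * size c = sumn c.
Proof.
elim: c p => [|x c IHc] p /=; first by rewrite muln0.
by move=> /andP[px /IHc <-]; rewrite sumn_cat sumn_nseq; nia.
Qed.

Lemma geq_trans : transitive geq.
Proof. by move=> x y z /= /[swap]; apply: leq_trans. Qed.

Lemma sorted_geq_cat s1 s2 : sorted geq s1 -> sorted geq s2 ->
  {in s1 & s2, forall x y, y <= x} -> sorted geq (s1 ++ s2).
Proof.
rewrite !(sorted_pairwise geq_trans) pairwise_cat => -> -> s12.
by rewrite !andbT; apply/allrelP.
Qed.

Lemma sorted_nseq k x : sorted geq (nseq k x).
Proof. by case: k => // k; elim: k => //= k ->; rewrite /= leqnn. Qed.

Lemma sorted_parts_of_counts p c : sorted geq (parts_of_counts p c).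
Proof.
elim: c p => //= x c IHc p; apply: sorted_geq_cat => //.
  exact: sorted_nseq.
move=> y z; rewrite mem_nseq => /andP[_ /eqP ->] /mem_parts_of_counts.
by case/andP=> _ /leqW.
Qed.

Lemma eq_counts_of_parts p t s1 s2 :
  (forall k, k <= t -> count_mem k s1 = count_mem k s2) ->
  counts_of_parts p t s1 = counts_of_parts p t s2.
Proof.
elim: t p => //= t IHt p s12; rewrite s12 // IHt // => k kt.
by rewrite s12 // leqW.
Qed.

Lemma parts_of_countsK p c :
  path leq p c -> counts_of_parts p (size c) (parts_of_counts p c) = c.
Proof.
elim: c p => //= x c IHc p /andP[px xc].
rewrite count_cat count_nseq /= eqxx mul1n.
rewrite (count_memPn _) ?addn0 ?subnKC //; last first.
  by apply/negP => /mem_parts_of_counts; rewrite ltnn andbF.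
congr cons; rewrite -[RHS](IHc x xc); apply: eq_counts_of_parts => k kc.
by rewrite count_cat count_nseq /= (_ : _ == k = false) //; lia.
Qed.

(** Once a nonincreasing sequence drops below [a], it stays there. Such cuts separate a partition
    into its blocks. *)
Lemma sorted_geq_split a s : sorted geq s ->
  [seq x <- s | a <= x] ++ [seq x <- s | x < a] = s.
Proof.
elim: s => //= x s IHs xs; have ss := path_sorted xs.
rewrite ltnNge; case: leqP => ax /=; first by rewrite IHs.
have /allP sx := order_path_min geq_trans xs.
have sa y : y \in s -> y < a by move/sx => /= yx; apply: leq_ltn_trans ax.
rewrite (eq_in_filter (a2 := pred0)) ?filter_pred0 => [|y /sa].
  by congr cons; apply/all_filterP/allP.
by move=> ya; rewrite leqNgt ya.
Qed.

Lemma filter_pred1 (x : nat) s :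
  [seq y <- s | y == x] = nseq (count_mem x s) x.
Proof. by elim: s => //= y s ->; case: eqP => // ->. Qed.

Lemma counts_of_partsK p t s : is_partition s ->
  parts_of_counts p (counts_of_parts p t s) = [seq x <- s | x <= t].
Proof.
case/andP=> ss s0; elim: t p => [|t IHt] p /=.
  rewrite (eq_in_filter (a2 := pred0)) ?filter_pred0 // => x xs /=.
  by rewrite leqn0; apply/negbTE; apply: contraNneq s0 => <-.
rewrite IHt size_counts_of_parts addKn -filter_pred1.
(* The parts at most [t + 1] are those equal to [t + 1], then those at most [t]. *)
have := sorted_geq_split t.+1 (sorted_filter geq_trans (fun x => x <= t.+1) ss).
rewrite -!filter_predI => <-; congr (_ ++ _); apply: eq_filter => x /=.
  by rewrite eqn_leq andbC.
by rewrite ltnS; lia.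
Qed.

(** * Decomposition of a partition around its fixed hook *)

Lemma sorted_rev_addn k g :
  sorted leq g -> sorted geq (rev [seq k + x | x <- g]).
Proof.
rewrite rev_sorted sorted_map; apply: sub_sorted => x y xy /=.
by rewrite leq_add2l.
Qed.

Lemma sorted_rev_subn k s :
  sorted geq s -> sorted leq (rev [seq x - k | x <- s]).
Proof.
rewrite rev_sorted sorted_map; apply: sub_sorted => x y xy /=.
exact: leq_sub2r.
Qed.

Lemma addn_subn_map k s :
  {in s, forall x, k <= x} -> [seq k + x | x <- [seq x - k | x <- s]] = s.
Proof.
move=> ks; rewrite -map_comp -[RHS]map_id; apply/eq_in_map => x /ks kx /=.
exact: subnKC.
Qed.

Lemma sumn_map_addn k g : sumn [seq k + x | x <- g] = k * size g + sumn g.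
Proof. by elim: g => [|x g /= ->] /=; rewrite ?muln0 //; lia. Qed.

Lemma mem_rev_addn k g x : x \in rev [seq k + y | y <- g] -> k <= x.
Proof. by rewrite mem_rev => /mapP[y _ ->]; apply: leq_addr. Qed.

(* If the hook of the cell (i, m) has length i, write lambda_i = m + t; then
   column m has 2 i - t - 1 cells, so that half of its excess over t + 1 is the
   leg length of this hook, and i = t + leg + 1. *)
Definition half_leg (m t : nat) (lam : seq nat) : nat :=
  (col_length lam m - t.+1)./2.

(** Since [half_leg] truncates, the first condition also says that the excess of the column over
    [t + 1] is nonnegative and even. *)
Definition fixed_hook_arm (m t : nat) (lam : seq nat) : bool :=
  (col_length lam m == t.+1 + (half_leg m t lam).*2)
  && (row_length lam (t + half_leg m t lam).+1 == m + t).

(** Here and below, reversal turns nonincreasing parts into the increasing sequences required by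
    sliding insertion. *)
Definition hook_top (m t : nat) (lam : seq nat) : seq nat :=
  rev [seq x - (m + t) | x <- take (t + half_leg m t lam) lam].

Definition hook_low (m t : nat) (lam : seq nat) : seq nat :=
  rev [seq x - m | x <- drop (t + half_leg m t lam).+1 [seq x <- lam | m <= x]].

Definition hook_join (m t : nat) (g b nu : seq nat) : seq nat :=
  rev [seq m + t + x | x <- g]
  ++ (m + t) :: rev [seq m + x | x <- b] ++ nu.

Definition hook_data (t : nat) (g b : seq nat) : Prop :=
  [/\ sorted leq g, sorted leq b, all (fun j => j <= t) b
    & size g = size b + t].

Lemma filter_partition (a : pred nat) s :
  is_partition s -> is_partition [seq x <- s | a x].
Proof.
case/andP=> ss s0; rewrite /is_partition (sorted_filter geq_trans) //=.
by rewrite mem_filter negb_and s0 orbT.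
Qed.

Lemma nth_sorted_geq s i j : sorted geq s -> i <= j -> nth 0 s j <= nth 0 s i.
Proof.
move=> ss ij; case: (ltnP j (size s)) => js; last by rewrite nth_default.
by apply: (sorted_leq_nth geq_trans leqnn 0 ss); rewrite ?inE // (leq_ltn_trans ij).
Qed.

Lemma hook_splitP m t lam : is_partition lam -> fixed_hook_arm m t lam ->
  hook_data t (hook_top m t lam) (hook_low m t lam) /\
  hook_join m t (hook_top m t lam) (hook_low m t lam) [seq x <- lam | x < m]
    = lam.
Proof.
move=> /andP[sl _] /andP[/eqP cl /eqP rl].
have lamE := sorted_geq_split m sl.
rewrite /hook_top /hook_low /hook_join.
move: (half_leg m t lam) cl rl => s cl; rewrite /row_length /= => rl.
set big := [seq x <- lam | m <= x] in lamE *.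
have sbig : size big = t.+1 + s.*2 by rewrite size_filter.
have ts : t + s < size big by rewrite sbig; lia.
have big_sorted : sorted geq big by apply: sorted_filter geq_trans _ _ sl.
have takeE : take (t + s) lam = take (t + s) big.
  by rewrite -[in LHS]lamE takel_cat // ltnW.
have bigE : big = take (t + s) big ++ (m + t) :: drop (t + s).+1 big.
  rewrite -[LHS](cat_take_drop (t + s)) (drop_nth 0 ts); congr (_ ++ _ :: _).
  by rewrite -rl -[in RHS]lamE nth_cat ts.
(* Cutting just after the entry [m + t] yields both bounds: earlier entries are at least [m + t],
   later ones at most [m + t]. *)
have : sorted geq (rcons (take (t + s) big) (m + t) ++ drop (t + s).+1 big).
  by rewrite cat_rcons -bigE.
rewrite (sorted_pairwise geq_trans) pairwise_cat => /and3P[/allrelP top_low].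
rewrite pairwise_rcons => /andP[/allP top_mid _] _.
have top_ge : {in take (t + s) big, forall x, m + t <= x} by [].
have low_le : {in drop (t + s).+1 big, forall x, x <= m + t}.
  by move=> x xd; apply: (top_low (m + t)); rewrite // mem_rcons mem_head.
have low_ge : {in drop (t + s).+1 big, forall x, m <= x}.
  by move=> x /mem_drop; rewrite mem_filter => /andP[].
split; last first.
  rewrite !map_rev !revK takeE !addn_subn_map //.
  by rewrite -[RHS]lamE [in RHS]bigE -catA.
split.
- exact/sorted_rev_subn/take_sorted.
- exact/sorted_rev_subn/drop_sorted.
- apply/allP => j; rewrite mem_rev => /mapP[x /low_le xm ->].
  by rewrite leq_subLR.
rewrite !size_rev !size_map takeE size_takel 1?ltnW // size_drop sbig.
by lia.
Qed.

Lemma hook_joinP m t g b nu : 0 < m -> hook_data t g b ->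
  is_partition nu -> all (fun k => k < m) nu ->
  let lam := hook_join m t g b nu in
  [/\ is_partition lam, fixed_hook_arm m t lam, hook_top m t lam = g,
      hook_low m t lam = b & [seq x <- lam | x < m] = nu].
Proof.
move=> m0 [sg sb /allP bt gb] /andP[snu nu0] /allP num lam.
have num' x : x \in nu -> (m <= x) = false by move/num; lia.
pose big := rev [seq m + t + x | x <- g] ++ (m + t) :: rev [seq m + x | x <- b].
have lamE : lam = big ++ nu by rewrite /lam /hook_join -catA.
have big_ge x : x \in big -> m <= x.
  rewrite mem_cat inE => /or3P[/mem_rev_addn|/eqP ->|/mem_rev_addn] //; lia.
have filter_lam : [seq x <- lam | m <= x] = big.
  rewrite lamE filter_cat (eq_in_filter (a2 := predT)) => [|x /big_ge -> //].
  rewrite (eq_in_filter (s := nu) (a2 := pred0)) => [|x /num' -> //].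
  by rewrite filter_predT filter_pred0 cats0.
have col_lam : col_length lam m = t.+1 + (size b).*2.
  rewrite /col_length -size_filter filter_lam size_cat /= !size_rev !size_map.
  by lia.
(* The leg is read off the column length alone, so both cutting positions are recovered. *)
have leg_lam : half_leg m t lam = size b by rewrite /half_leg col_lam; lia.
have top_size : size (rev [seq m + t + x | x <- g]) = t + size b.
  by rewrite size_rev size_map gb addnC.
split.
- apply/andP; split; last first.
    rewrite lamE mem_cat (negbTE nu0) orbF; apply/negP => /big_ge; lia.
  rewrite lamE; apply: sorted_geq_cat => //; last first.
    by move=> x y /big_ge mx /num ym; lia.
  apply: sorted_geq_cat; first exact: sorted_rev_addn.
    rewrite -cat1s; apply: sorted_geq_cat => //; first exact: sorted_rev_addn.
    move=> x y; rewrite inE mem_rev => /eqP -> /mapP[j /bt jt ->].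
    by rewrite leq_add2l.
  move=> x y /mem_rev_addn xm; rewrite inE => /orP[/eqP ->//|].
  by rewrite mem_rev => /mapP[j /bt jt ->]; lia.
- rewrite /fixed_hook_arm leg_lam col_lam eqxx /row_length /=.
  by rewrite /lam /hook_join nth_cat top_size ltnn subnn /=.
- rewrite /hook_top leg_lam -top_size take_size_cat // map_rev revK.
  by rewrite (mapK (addKn _)).
- rewrite /hook_low leg_lam filter_lam /big -cat_rcons drop_size_cat; last first.
    by rewrite size_rcons top_size.
  by rewrite map_rev revK (mapK (addKn _)).
rewrite lamE filter_cat (eq_in_filter (a2 := pred0)) => [|x /big_ge mx]; last first.
  by rewrite ltnNge mx.
by rewrite filter_pred0 (eq_in_filter (a2 := predT)) ?filter_predT // => x /num.
Qed.

(** Grouped to match [sumn_gap_join]: the first term is also the weight of [m + t] parts [t + 1],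
    the second that of the shifts [2 * m + t]. *)
Lemma sumn_hook_join m t g b nu : size g = size b + t ->
  sumn (hook_join m t g b nu)
    = (m + t) * t.+1 + (2 * m + t) * size b + (sumn g + sumn b) + sumn nu.
Proof.
move=> gb; rewrite /hook_join !(sumn_cat, sumn_rev, sumn_map_addn) /=.
by rewrite !(sumn_cat, sumn_rev, sumn_map_addn) gb; nia.
Qed.

(** * Decomposition of a partition around a part [t + 1] with the required frequency and gap *)

Definition gap_low (t : nat) (mu : seq nat) : seq nat :=
  counts_of_parts 0 t mu.

Definition gap_high (m t : nat) (mu : seq nat) : seq nat :=
  rev [seq x - (2 * m + t) | x <- [seq x <- mu | t.+1 < x]].

Definition gap_join (m t : nat) (c e : seq nat) : seq nat :=
  rev [seq 2 * m + t + x | x <- e]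
  ++ nseq (t + m) t.+1 ++ parts_of_counts 0 c.

(** For [L = t + 1] the forbidden window ends at [2 * m + t - 1], so every part above [L] must jump
    to at least [2 * m + t]. *)
Lemma frequency_gapE m t mu : 0 < m ->
  frequency_gap m t.+1 mu
    = (count_mem t.+1 mu == t + m)
      && all (fun x => (t.+1 < x) ==> (2 * m + t <= x)) mu.
Proof.
move=> m0; rewrite /frequency_gap (_ : t.+1 + m - 1 = t + m); last by lia.
congr (_ && _); apply/allP/allP => H x.
  move=> xmu; apply/implyP => tx; rewrite leqNgt; apply/negP => xt.
  by have := H x; rewrite mem_index_iota xmu => /(_ _)/negP; apply => //; lia.
rewrite mem_index_iota => xt; apply/negP => /H; lia.
Qed.

Lemma gap_splitP m t mu : 0 < m -> is_partition mu ->
  frequency_gap m t.+1 mu ->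
  [/\ sorted leq (gap_low t mu), size (gap_low t mu) = t,
      sorted leq (gap_high m t mu)
    & gap_join m t (gap_low t mu) (gap_high m t mu) = mu].
Proof.
move=> m0 pmu; rewrite frequency_gapE // => /andP[/eqP cmu /allP gap].
have /andP[smu _] := pmu; split.
- exact: path_sorted (path_counts_of_parts 0 t mu).
- exact: size_counts_of_parts.
- exact/sorted_rev_subn/(sorted_filter geq_trans).
rewrite /gap_join /gap_low /gap_high map_rev revK addn_subn_map; last first.
  by move=> x; rewrite mem_filter => /andP[tx /gap]; rewrite tx.
rewrite counts_of_partsK // -cmu -filter_pred1.
rewrite -[RHS](sorted_geq_split t.+2 smu); congr (_ ++ _).
(* A second cut separates the parts equal to [t + 1] from the smaller ones. *)
have := sorted_geq_split t.+1 (sorted_filter geq_trans (fun x => x < t.+2) smu).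
rewrite -!filter_predI => <-; congr (_ ++ _); apply: eq_filter => x /=.
  by rewrite eqn_leq andbC.
by rewrite !ltnS; lia.
Qed.

Lemma gap_joinP m t c e : 0 < m ->
  sorted leq c -> size c = t -> sorted leq e ->
  let mu := gap_join m t c e in
  [/\ is_partition mu, frequency_gap m t.+1 mu, gap_low t mu = c
    & gap_high m t mu = e].
Proof.
move=> m0 sc ct se mu.
have pc : path leq 0 c by case: (c) sc.
have low_lt x : x \in parts_of_counts 0 c -> 0 < x <= t.
  by move/mem_parts_of_counts; rewrite ct.
(* As [m > 0], the shifted parts are at least [t + 2], so they do not disturb the lower counts. *)
have count_high k : k <= t.+1 -> count_mem k (rev [seq 2 * m + t + x | x <- e]) = 0.
  move=> kt; apply/count_memPn/negP => /mem_rev_addn; lia.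
split.
- apply/andP; split.
    apply: sorted_geq_cat; first exact: sorted_rev_addn.
      apply: sorted_geq_cat; [exact: sorted_nseq|exact: sorted_parts_of_counts|].
      by move=> x y; rewrite mem_nseq => /andP[_ /eqP ->] /low_lt; lia.
    move=> x y /mem_rev_addn xm; rewrite mem_cat mem_nseq.
    by move=> /orP[/andP[_ /eqP ->]|/low_lt]; lia.
  rewrite !mem_cat mem_nseq andbF orFb negb_or.
  by apply/andP; split; apply/negP; [move/mem_rev_addn|move/low_lt]; lia.
- rewrite frequency_gapE // !count_cat count_high // count_nseq /= eqxx mul1n.
  rewrite add0n (count_memPn _) ?addn0 ?eqxx; last first.
    by apply/negP => /low_lt; rewrite ltnn andbF.
  apply/allP => x; rewrite !mem_cat mem_nseq.
  by move=> /or3P[/mem_rev_addn|/andP[_ /eqP]|/low_lt]; lia.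
- rewrite -[RHS](parts_of_countsK pc) ct; apply: eq_counts_of_parts => k kt.
  rewrite !count_cat count_high ?leqW // count_nseq /=.
  by rewrite (_ : t.+1 == k = false) //; lia.
rewrite /gap_high !filter_cat (eq_in_filter (a2 := predT)); last first.
  by move=> x /mem_rev_addn /= xm; lia.
rewrite (eq_in_filter (s := nseq _ _) (a2 := pred0)); last first.
  by move=> x; rewrite mem_nseq => /andP[_ /eqP ->]; rewrite ltnn.
rewrite (eq_in_filter (s := parts_of_counts _ _) (a2 := pred0)); last first.
  by move=> x /low_lt /=; lia.
by rewrite filter_predT !filter_pred0 !cats0 map_rev revK (mapK (addKn _)).
Qed.

Lemma sumn_gap_join m t c e : sorted leq c -> size c = t ->
  sumn (gap_join m t c e)
    = (m + t) * t.+1 + (2 * m + t) * size e + (sumn c + sumn e).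
Proof.
move=> sc ct; have pc : path leq 0 c by case: (c) sc.
rewrite /gap_join !(sumn_cat, sumn_rev, sumn_map_addn) sumn_nseq.
by have := sumn_parts_of_counts pc; nia.
Qed.

(** * The bijection for a fixed arm [t] and the resulting equality of cardinalities *)

Definition hook_to_gap (m t : nat) (lam : seq nat) : seq nat * seq nat :=
  let g := hook_top m t lam in let b := hook_low m t lam in
  (gap_join m t (split_core g b) (split_ext g b), [seq x <- lam | x < m]).

Definition gap_to_hook (m t : nat) (p : seq nat * seq nat) : seq nat :=
  let c := gap_low t p.1 in let e := gap_high m t p.1 in
  hook_join m t (merge_top c e) (merge_low c e) p.2.

Lemma hook_to_gapP m n t lam : 0 < m ->
  is_partition lam && (sumn lam == n) -> fixed_hook_arm m t lam ->
  [/\ is_two_colored m n (hook_to_gap m t lam),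
      frequency_gap m t.+1 (hook_to_gap m t lam).1
    & gap_to_hook m t (hook_to_gap m t lam) = lam].
Proof.
move=> m0 /andP[plam /eqP <-] hlam.
have [[sg sb bt gb] lamE] := hook_splitP plam hlam.
rewrite /gap_to_hook /hook_to_gap /=.
set g := hook_top m t lam in sg gb lamE *.
set b := hook_low m t lam in sb bt gb lamE *.
set nu := [seq x <- lam | x < m] in lamE *.
have sc : sorted leq (split_core g b) by apply: sorted_split_core.
have zc : size (split_core g b) = t by apply: size_split_core.
have se : sorted leq (split_ext g b) by apply: sorted_split_ext bt gb sg sb.
have [gK bK] := split_mergeK bt gb sg.
have [pmu gmu lowK highK] := gap_joinP m0 sc zc se.
rewrite lowK highK gK bK lamE; split=> //; apply/and4P; split=> //=.
- exact: filter_partition.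
- exact: filter_all.
(* The two sums share their constant terms; [sumn_merge] equates the rest. *)
rewrite sumn_gap_join // -lamE sumn_hook_join // size_split_ext.
by have := sumn_merge (split_core g b) (split_ext g b); rewrite gK bK => ->.
Qed.

Lemma gap_to_hookP m n t p : 0 < m ->
  is_two_colored m n p -> frequency_gap m t.+1 p.1 ->
  [/\ is_partition (gap_to_hook m t p) && (sumn (gap_to_hook m t p) == n),
      fixed_hook_arm m t (gap_to_hook m t p)
    & hook_to_gap m t (gap_to_hook m t p) = p].
Proof.
move=> m0; case: p => mu nu /and4P[/= pmu pnu num /eqP <-] gmu.
have [sc zc se muE] := gap_splitP m0 pmu gmu.
rewrite /hook_to_gap /gap_to_hook /=.
set c := gap_low t mu in sc zc muE *.
set e := gap_high m t mu in se muE *.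
have gb : size (merge_top c e) = size (merge_low c e) + t.
  by rewrite size_merge_top size_merge_low zc.
have data : hook_data t (merge_top c e) (merge_low c e).
  split=> //; [exact: sorted_merge_top|exact: sorted_merge_low|].
  by rewrite -zc merge_low_leq.
have [plam hlam -> -> ->] := hook_joinP m0 data pnu num.
rewrite merge_topK merge_lowK muE plam; split=> //.
by rewrite sumn_hook_join // sumn_merge size_merge_low -muE sumn_gap_join // eqxx.
Qed.

(** The left inverse [g] makes [f] injective on [A]. Working on the carrier types keeps membership
    proofs out of both maps. *)
Lemma leq_card_sub (T1 T2 : eqType) (P1 : pred T1) (P2 : pred T2)
    (S1 : subFinType P1) (S2 : subFinType P2) (A : pred T1) (B : pred T2)
    (f : T1 -> T2) (g : T2 -> T1) :
  (forall x, P1 x -> A x -> [/\ P2 (f x), B (f x) & g (f x) = x]) ->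
  #|[pred x : S1 | A (val x)]| <= #|[pred y : S2 | B (val y)]|.
Proof.
move=> fP.
rewrite !cardE -(size_map (f \o val)) -(size_map val (enum [pred y : S2 | _])).
apply: uniq_leq_size.
  rewrite map_inj_in_uniq ?enum_uniq // => x y; rewrite !mem_enum !inE => Ax Ay fxy.
  apply: val_inj; have [_ _ <-] := fP _ (valP x) Ax.
  by have [_ _ <-] := fP _ (valP y) Ay; congr g.
move=> _ /mapP[x + ->]; rewrite mem_enum inE => Ax.
have [Pfx Bfx _] := fP _ (valP x) Ax; apply/mapP.
by exists (Sub (f (val x)) Pfx); rewrite ?mem_enum ?inE SubK.
Qed.

Lemma card_fixed_hook_arm m n t : 0 < m ->
  #|[pred lam : intpart n | fixed_hook_arm m t lam]| = n_frequency_gap m n t.+1.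
Proof.
move=> m0; apply/eqP; rewrite eqn_leq; apply/andP; split.
  apply: (@leq_card_sub _ _ _ _ _ _ (fixed_hook_arm m t)
    (fun p => frequency_gap m t.+1 p.1) (hook_to_gap m t) (gap_to_hook m t)).
  by move=> lam; apply: hook_to_gapP.
apply: (@leq_card_sub _ _ _ _ _ _ (fun p => frequency_gap m t.+1 p.1)
  (fixed_hook_arm m t) (gap_to_hook m t) (hook_to_gap m t)).
by move=> p; apply: gap_to_hookP.
Qed.

(** * Uniqueness of the fixed hook and summation over [t] *)

Lemma leq_col_length m lam k : 0 < m -> sorted geq lam ->
  m <= nth 0 lam k -> k < col_length lam m.
Proof.
move=> m0 sl mk; rewrite /col_length ltnNge -size_filter; apply/negP => ck.
have := sorted_geq_split m sl; set u := [seq x <- lam | m <= x] in ck *.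
(* Because [m > 0], the default value [0] cannot satisfy [mk]. *)
have kl : k < size lam.
  by rewrite ltnNge; apply/negP => lk; move: mk; rewrite nth_default //; lia.
move=> lamE; move: mk kl; rewrite -lamE nth_cat size_cat ltnNge ck /= => mk kl.
have : nth 0 [seq x <- lam | x < m] (k - size u) \in [seq x <- lam | x < m].
  by apply: mem_nth; rewrite ltn_subLR.
by rewrite mem_filter ltnNge mk.
Qed.

(** The column length fixes [t + 2 * s], with [s] the leg, so a larger [t] puts the hook in a lower
    row, yet demands a longer one. *)
Lemma fixed_hook_arm_inj m t1 t2 lam : sorted geq lam ->
  fixed_hook_arm m t1 lam -> fixed_hook_arm m t2 lam -> t1 = t2.
Proof.
move=> sl /andP[/eqP c1 /eqP r1] /andP[/eqP c2 /eqP r2].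
have [le_t|lt_t] := leqP t1 t2.
  have := @nth_sorted_geq lam (t1 + half_leg m t1 lam) (t2 + half_leg m t2 lam) sl.
  by move: r1 r2; rewrite /row_length /= => -> ->; lia.
have := @nth_sorted_geq lam (t2 + half_leg m t2 lam) (t1 + half_leg m t1 lam) sl.
by move: r1 r2; rewrite /row_length /= => -> ->; lia.
Qed.

Lemma has_fixed_hookP m lam : 0 < m -> sorted geq lam ->
  reflect (exists2 t, t < sumn lam & fixed_hook_arm m t lam)
          (has_fixed_hook 0%R m lam).
Proof.
move=> m0 sl; apply: (iffP hasP) => [[i]|[t tl /andP[/eqP cl /eqP rl]]].
  rewrite mem_iota => /andP[i0 il] /andP[mi /eqP]; rewrite /hook_length => hi.
  (* With [t] the arm, the column has [2 * i - t - 1] cells; this bound gives [t + 1 <= i], making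
     the leg [i - (t + 1)] an exact subtraction. *)
  have ci : i <= col_length lam m.
    by rewrite -(prednK i0); apply: leq_col_length.
  have lami : row_length lam i <= sumn lam.
    by apply: leq_sumn_mem; apply: mem_nth; rewrite prednK.
  have rl : row_length lam i = m + (row_length lam i - m) by lia.
  exists (row_length lam i - m); first by lia.
  have leg : half_leg m (row_length lam i - m) lam = i - (row_length lam i - m).+1.
    by rewrite /half_leg; lia.
  apply/andP; rewrite leg; split; first by apply/eqP; lia.
  have -> : (row_length lam i - m + (i - (row_length lam i - m).+1)).+1 = i by lia.
  by rewrite -rl.
set s := half_leg m t lam in cl rl.
exists (t + s).+1; last by rewrite /hook_length rl cl leq_addr; apply/eqP; lia.
(* Beyond the last row the length would default to [0], but it is [m + t > 0]. *)
rewrite mem_iota add1n ltnS /= ltnNge; apply/negP => lts.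
by move: rl; rewrite /row_length nth_default //=; lia.
Qed.

Lemma has_fixed_hook_sum m lam : 0 < m -> sorted geq lam ->
  has_fixed_hook 0%R m lam = \sum_(t < sumn lam) fixed_hook_arm m t lam :> nat.
Proof.
move=> m0 sl; case: has_fixed_hookP => // [[t tl ht]|no_hook].
  rewrite (bigD1 (Ordinal tl)) //= ht big1 // => u /eqP ut.
  apply/eqP; rewrite eqb0; apply/negP => hu; apply/ut/val_inj => /=.
  exact: fixed_hook_arm_inj sl hu ht.
rewrite big1 // => t _; apply/eqP; rewrite eqb0; apply/negP => ht.
by apply: no_hook; exists (val t) => //; apply: ltn_ord.
Qed.

Lemma n_fixed_hook_sum m n : 0 < m ->
  n_fixed_hook 0%R m n = \sum_(t < n) n_frequency_gap m n t.+1.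
Proof.
move=> m0; under eq_bigr do rewrite -card_fixed_hook_arm // -sum1_card big_mkcond.
(* Double counting: each partition contributes once per admissible [t], and there is at most one. *)
rewrite exchange_big /n_fixed_hook -sum1_card big_mkcond /=.
apply: eq_bigr => lam _; rewrite !inE.
have /andP[/andP[sl _] /eqP lamn] := valP lam.
transitivity (nat_of_bool (has_fixed_hook 0%R m lam)); first by case: ifP.
rewrite has_fixed_hook_sum // lamn; apply: eq_bigr => t _.
by rewrite inE; case: ifP.
Qed.

(** A positive [L] with the frequency condition occurs [L + m - 1 > 0] times, so it is automatically
    a part and at most [n]. *)
Lemma count_frequency_gap m n mu : 0 < m -> is_partition mu -> sumn mu <= n ->
  count (fun L => frequency_gap m L mu) (undup mu)
    = \sum_(t < n) frequency_gap m t.+1 mu.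
Proof.
move=> m0 /andP[_ mu0] mun; set a := fun L => _.
transitivity (count a (index_iota 1 n.+1)).
  rewrite -!size_filter; apply/perm_size/uniq_perm.
  - exact/filter_uniq/undup_uniq.
  - exact/filter_uniq/iota_uniq.
  move=> L; rewrite !mem_filter mem_undup mem_index_iota ltnS.
  apply: andb_id2l => /andP[/eqP cL _]; apply/idP/idP => [Lmu|/andP[L0 _]].
    rewrite lt0n (leq_trans (leq_sumn_mem Lmu) mun) andbT.
    by apply: contraNneq mu0 => <-.
  by rewrite -has_pred1 has_count cL; lia.
rewrite -sum1_count big_add1 big_mkord big_mkcond /=.
by apply: eq_bigr => t _; rewrite /a; case: ifP.
Qed.

Lemma n_occurrences_sum m n : 0 < m ->
  n_occurrences m n = \sum_(t < n) n_frequency_gap m n t.+1.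
Proof.
move=> m0; under [RHS]eq_bigr do rewrite /n_frequency_gap -sum1_card big_mkcond.
rewrite exchange_big; apply: eq_bigr => p _.
have /and4P[pmu _ _ /eqP pn] := valP p.
by rewrite (@count_frequency_gap m n) // -[X in _ <= X]pn leq_addr.
Qed.

Theorem theorem1p1 (m n : nat) (hm : (1 <= m)%N) :
  n_fixed_hook 0%R m n
    = (\sum_(L \in [set L : nat | (1 <= L)%N]%classic) n_frequency_gap m n L)%R
  /\
  n_fixed_hook 0%R m n = n_occurrences m n.
Proof.
split; last by rewrite n_fixed_hook_sum // n_occurrences_sum.
(* All nonzero terms have [1 <= L <= n], so the finitely supported sum is a sum over this range,
   reindexed by [L = t + 1]. *)
rewrite n_fixed_hook_sum // (@fsbigE _ _ _ _ _ (index_iota 1 n.+1)) ?iota_uniq //=.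
- by rewrite big_add1 big_mkord; apply: eq_bigl => t; apply/esym/mem_set.
- by move=> L /=; rewrite mem_index_iota => /andP[].
move=> L /= L1; rewrite mem_index_iota L1 ltnS -ltnNge => nL.
exact: n_frequency_gap_eq0.
Qed.
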